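(* Let $\mathcal{H}$ be a real Hilbert space, let $\lambda>0$, $\mu=\frac{1}{\lambda}$, and let $\Phi:\mathcal{H}\to\mathbb{R}^+\cup\{+\infty\}$ be a closed convex function such that $C=\mathrm{argmin}\,\Phi=\Phi^{-1}(0)\neq\emptyset$. Let $\varepsilon:[0,+\infty[\to[0,+\infty[$ satisfy: (H1) for every $p\in R(N_C)$, $\displaystyle\int_0^{+\infty}\Big(\mu\Phi^*\big(\tfrac{1}{\mu}\varepsilon(t)p\big)-\sigma_C(\varepsilon(t)p)+\tfrac12\|\varepsilon(t)p\|^2\Big)dt<+\infty$; (H2) $\varepsilon(\cdot)$ is nonincreasing, of class $C^1$, Lipschitz continuous on $[0,+\infty[$, $\lim_{t\to+\infty}\varepsilon(t)=0$, $\int_0^{+\infty}\varepsilon(t)dt=+\infty$, and for some $k\ge0$, $-k\varepsilon^2\le\dot\varepsilon$. Let $(x(\cdot),\upsilon(\cdot)):[0,+\infty[\to\mathcal{H}\times\mathcal{H}$ be a strong global solution of $$\upsilon(t)\in\partial\Phi(x(t)),\qquad \lambda\dot x(t)+\dot\upsilon(t)+\upsilon(t)+\varepsilon(t)x(t)=0$$ (with some initial data $x(0)=x_0$, $\upsilon(0)=\upsilon_0\in\partial\Phi(x_0)$), and set $y(t)=x(t)+\mu\upsilon(t)$. Then (i) $y(t)$ converges weakly, as $t\to+\infty$, to $\mathrm{proj}_{\mathrm{argmin}\Phi}0$. If moreover $\Phi(0)<+\infty$, then (ii) $x(t)$ and $y(t)$ both converge weakly, as $t\to+\infty$, to $\mathrm{proj}_{\mathrm{argmin}\Phi}0$;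 (iii) $\upsilon(t)\to0$ strongly, and hence $x(t)-y(t)\to0$ strongly, as $t\to+\infty$.
   Context: $\Phi^*$ is the Fenchel conjugate of $\Phi$; $\sigma_C(x^* )=\sup_{c\in C}\langle x^*,c\rangle$ is the support function of $C$; $N_C(x)=\{x^*:\langle x^*,c-x\rangle\le0\ \forall c\in C\}$ for $x\in C$ (empty otherwise) is the normal cone, and $R(N_C)=\bigcup_{x\in C}N_C(x)$ its range. $\mathrm{proj}_{\mathrm{argmin}\Phi}0$ is the element of minimal norm of the closed convex set $C$. A strong global solution means $x,\upsilon$ absolutely continuous on every bounded interval $[0,b]$, $\upsilon(t)\in\partial\Phi(x(t))$ for all $t\ge0$, and the differential equation holding for almost every $t\ge0$. *)

(* Defs.v *)
From HB Require Import structures.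
From mathcomp Require Import all_boot all_order all_algebra.
From mathcomp Require Import all_classical all_reals all_analysis.
Set Implicit Arguments. Unset Strict Implicit. Unset Printing Implicit Defensive.
Import Order.TTheory GRing.Theory Num.Theory.
Import numFieldNormedType.Exports.
Local Open Scope classical_set_scope.
Local Open Scope ring_scope.

Section Defs.
Variables (R : realType) (H : normedModType R).

(* ip is an inner product on H inducing its norm (real inner product space;
   together with completeness of H this gives a real Hilbert space). *)
Definition is_inner_product (ip : H -> H -> R) : Prop :=
  [/\ (forall x y, ip x y = ip y x),
      (forall (a : R) x y z, ip (a *: x + y) z = a * ip x z + ip y z)
    & (forall x, ip x x = `|x| ^+ 2)].

Definition convex_fun (Phi : H -> \bar R) : Prop :=
  forall (a : R) x y, 0 <= a <= 1 ->
    (Phi (a *: x + (1 - a) *: y)%R <= a%:E * Phi x + (1 - a)%:E * Phi y)%E.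

(* closed = lower semicontinuous: all sublevel sets are closed *)
Definition closed_fun (Phi : H -> \bar R) : Prop :=
  forall a : R, closed [set x | (Phi x <= a%:E)%E].

Definition fenchel (ip : H -> H -> R) (Phi : H -> \bar R) (p : H) : \bar R :=
  ereal_sup [set ((ip p x)%:E - Phi x)%E | x in [set: H]].

Definition support_fun (ip : H -> H -> R) (C : set H) (p : H) : \bar R :=
  ereal_sup [set (ip p c)%:E | c in C].

Definition normal_cone (ip : H -> H -> R) (C : set H) (x : H) : set H :=
  [set p | C x /\ forall c, C c -> ip p (c - x) <= 0].

Definition range_normal_cone (ip : H -> H -> R) (C : set H) : set H :=
  [set p | exists2 x, C x & normal_cone ip C x p].

Definition subdiff (ip : H -> H -> R) (Phi : H -> \bar R) (x : H) : set H :=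
  [set v | (Phi x < +oo)%E /\
           forall y, (Phi x + (ip v (y - x))%:E <= Phi y)%E].

(* p is the element of minimal norm of C, i.e. proj_C 0 *)
Definition min_norm_elt (C : set H) (p : H) : Prop :=
  C p /\ forall c, C c -> `|p| <= `|c|.

Definition abs_cont_on_0b (f : R -> H) (b : R) : Prop :=
  forall e : R, 0 < e -> exists2 d : R, 0 < d &
    forall (n : nat) (a c : nat -> R),
      (forall i, (i < n)%N -> 0 <= a i /\ a i <= c i /\ c i <= b) ->
      (forall i, (i.+1 < n)%N -> c i <= a i.+1) ->
      \sum_(i < n) (c i - a i) < d ->
      \sum_(i < n) `|f (c i) - f (a i)| < e.

Definition weak_cvg_oo (ip : H -> H -> R) (f : R -> H) (l : H) : Prop :=
  forall z, ip (f t) z @[t --> +oo] --> ip l z.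

End Defs.

(* Main.v *)
Require Import Defs.
From HB Require Import structures.
From mathcomp Require Import all_boot all_order all_algebra.
From mathcomp Require Import all_classical all_reals all_analysis.
From mathcomp Require Import measurable_realfun.
From mathcomp Require Import ring lra.
Import Order.TTheory GRing.Theory Num.Theory.
Import numFieldNormedType.Exports.
Local Open Scope classical_set_scope.
Local Open Scope ring_scope.

(** With [mu = 1/lam], the equation reads [y' = - mu (v + eps x)] almost
    everywhere, and [N t = |y t - p|^2] satisfies, for every [eta > 0] and all
    large [t], the Gronwall-type inequality [N' <= - eps (mu/2 N - eta)].  The
    error term can be made small because the minimal norm over the sublevel set
    [Phi <= r] tends to [|p|] as [r] decreases to 0 (a parallelogram-identity
    argument).  Since [eps] has infinite integral, [N] tends to 0: the
    convergence of [y] is in fact strong.  As [p] minimises [Phi],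
    [|x - p|^2 + mu^2 |v|^2 <= |y - p|^2], so [x] tends to [p] and [v] to 0.
    Absolute continuity and the almost everywhere bound on [N'] are combined
    through a continuous induction along [[a, b]]: outside an open set of small
    measure the slope is controlled, and inside it the variation is small. *)

(** * Absolutely continuous functions with an almost everywhere slope bound *)

(** The limit of difference quotients multiplied through by [s - t], so that [s = t] is allowed. It
    gives the local slope control off the exceptional set. *)
Lemma derive_approx (R : realType) (V : normedModType R) (f : R -> V) (t e : R) :
  derivable f t 1 -> 0 < e -> exists2 d : R, 0 < d &
    forall s, `|s - t| < d -> `|f s - f t - (s - t) *: 'D_1 f t| <= e * `|s - t|.
Proof.
move=> df e0; move/cvgrPdist_lt: (df) => /(_ _ e0).
rewrite /= near_withinE => /nbhs_ballP[d d0 Hd]; exists d => // s std.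
have [->|st] := eqVneq s t; first by rewrite !subrr scale0r subrr !normr0 mulr0.
have st0 : s - t != 0 by rewrite subr_eq0.
have := Hd (s - t); rewrite -ball_normE /= sub0r normrN => /(_ std st0).
rewrite /shift /= [_ *: 1]mulr1 subrK => /ltW; rewrite distrC.
have -> : (s - t)^-1 *: (f s - f t) - 'D_1 f t =
   (s - t)^-1 *: (f s - f t - (s - t) *: 'D_1 f t).
  by rewrite [RHS]scalerBr scalerA mulVf // scale1r.
by rewrite normrZ normfV ler_pdivrMl ?normr_gt0 // mulrC.
Qed.

(** The supremum of the points satisfying [P] satisfies [P] by the step from its left; if it were
    below [b], the step to its right would produce a larger such point. *)
Lemma real_induction (R : realType) (P : R -> Prop) (a b : R) : a <= b -> P a ->
  (forall s, a <= s <= b -> exists2 d : R, 0 < d & forall t, a <= t <= b ->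
     (s - d < t <= s -> P t -> P s) /\ (s <= t < s + d -> P s -> P t)) ->
  P b.
Proof.
move=> ab Pa step; pose S := [set t | a <= t <= b /\ P t].
have Sa : S a by split; rewrite ?lexx.
have hS : has_sup S by split; [exists a | exists b => t [/andP[_ ?] _]].
have as_ : a <= sup S by apply: sup_upper_bound.
have sb : sup S <= b by apply: ge_sup => [|t [/andP[_ ?] _] //]; exists a.
have [|d d0 Hd] := step (sup S); first by rewrite as_ sb.
have Ps : P (sup S).
  have [t [tab Pt] st] := sup_adherent d0 hS.
  have ts : t <= sup S by apply: sup_upper_bound.
  by apply: (Hd t tab).1; rewrite ?st ?ts.
move: sb; rewrite le_eqVlt => /orP[/eqP<- //|sb].
pose t := Num.min b (sup S + d / 2).
have st : sup S < t by rewrite /t lt_min sb ltrDl divr_gt0.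
have tb : t <= b by rewrite /t ge_min lexx.
have td : t < sup S + d by rewrite /t gt_min; apply/orP; right; lra.
have tab : a <= t <= b by rewrite tb andbT (le_trans as_) // ltW.
have Pt : P t by apply: (Hd t tab).2; rewrite ?td ?(ltW st).
have : t <= sup S by apply: sup_upper_bound.
by rewrite leNgt st.
Qed.

Section absolute_continuity.
Variable R : realType.
Notation mu := (@lebesgue_measure R).

(* [covered g U K a t]: up to slope [K], the increase of [g] on [[a, t]] is
   carried by finitely many intervals of total length at most [mu U]. *)
Definition covered (g : R -> R) (U : set R) (K a t : R) : Prop :=
  exists (n : nat) (l r : nat -> R),
  [/\ forall i, (i < n)%N -> a <= l i /\ l i <= r i /\ r i <= t,
      forall i, (i.+1 < n)%N -> r i <= l i.+1,
      ((\sum_(i < n) (r i - l i))%:E <= mu (U `&` `]a, t]))%E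
    & g t - g a <= K * (t - a) +
        \sum_(i < n) (`|g (r i) - g (l i)| + `|K| * (r i - l i))].

(** Induction step off [U]: the increase is paid by [K * (t - a)], and the intervals stay the
    same. *)
Lemma covered_slope (g : R -> R) (U : set R) (K a s t : R) : measurable U -> s <= t ->
  g t - g s <= K * (t - s) -> covered g U K a s -> covered g U K a t.
Proof.
move=> mU st gst [n [l [r [H1 H2 H3 H4]]]]; exists n, l, r; split => //.
- by move=> i /H1[? [? ?]]; split => //; split => //; apply: le_trans st.
- apply: (le_trans H3); apply: le_measure; rewrite ?inE.
  + by apply: measurableI.
  + by apply: measurableI.
  + by apply: setIS; apply: subset_itvl; rewrite bnd_simp.
- by lra.
Qed.

(** Induction step inside [U]: [[s, t]] becomes a new interval. Its term [|K| * (t - s)] is there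
    because [K * (t - s)] may be negative. *)
Lemma covered_add (g : R -> R) (U : set R) (K a s t : R) : measurable U -> a <= s -> s <= t ->
  `[s, t] `<=` U -> covered g U K a s -> covered g U K a t.
Proof.
move=> mU as_ st stU [n [l [r [H1 H2 H3 H4]]]].
exists n.+1, (fun i => if (i < n)%N then l i else s),
  (fun i => if (i < n)%N then r i else t); split.
- move=> i _; case: ifPn => // /H1[? [? ?]].
  by split => //; split => //; apply: le_trans st.
- move=> i; rewrite ltnS => i1n; rewrite i1n; case: ifPn => [/H2 //|_].
  by have [_ []] := H1 _ i1n.
- rewrite big_ord_recr /= ltnn.
  under eq_bigr do rewrite ltn_ord /=.
  rewrite EFinD (_ : U `&` `]a, t] = (U `&` `]a, s]) `|` `]s, t]%classic); last first.
    rewrite (_ : `]a, t]%classic = `]a, s] `|` `]s, t]).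
      rewrite setIUr; congr (_ `|` _); apply/setIidPr.
      by apply: subset_trans stU; apply: subset_itvr; rewrite bnd_simp.
    by rewrite -itv_bndbnd_setU ?bnd_simp.
  rewrite measureU //.
  + apply: leeD => //.
    rewrite -[leRHS]/(mu `]s, t]) lebesgue_measure_itv /= lte_fin; case: ltP => [_|ts]; rewrite ?EFinB //.
    by rewrite lee_fin; lra.
  + by apply: measurableI.
  + apply/seteqP; split => // z /= [[_]]; rewrite !in_itv /= => /andP[_ zs] /andP[sz _].
    by move: (le_lt_trans zs sz); rewrite ltxx.
- rewrite big_ord_recr /= ltnn.
  under eq_bigr do rewrite ltn_ord /=.
  have := ler_norm (g t - g s); have := ler_norm (- (K * (t - s))).
  by rewrite normrN normrM (@ger0_norm _ (t - s)) ?subr_ge0 //; lra.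
Qed.

Lemma abs_cont_slope_le (g : R -> R) (a b K : R) : 0 <= a -> a <= b ->
  abs_cont_on_0b g b ->
  {ae mu, forall t, a <= t <= b -> derivable g t 1 /\ 'D_1 g t <= K} ->
  g b - g a <= K * (b - a).
Proof.
move=> a0 ab acg [N [mN muN0 subN]].
suff H (e : R) : 0 < e -> g b - g a <= (K + e) * (b - a) + 2 * e.
  apply/ler_addgt0Pr => e e0.
  (* The total excess is [b - a + 2] times the tolerance, which is scaled accordingly. *)
  have c0 : 0 < b - a + 2 by lra.
  have := H (e / (b - a + 2)); rewrite divr_gt0 // => /(_ isT) /le_trans; apply.
  have -> : (K + e / (b - a + 2)) * (b - a) + 2 * (e / (b - a + 2)) =
    K * (b - a) + (e / (b - a + 2)) * (b - a + 2) by ring.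
  by rewrite divfK // gt_eqF.
move=> e0; have [d d0 Hd] := acg e e0.
(* A total length below [d'] keeps both error sums of [covered] at most [e]: the variation of [g] by
   absolute continuity, the multiple [|K + e|] of the length by the second bound. *)
pose d' := Num.min d (e / (`|K + e| + 1)).
have Ke0 : 0 < `|K + e| + 1 by have := normr_ge0 (K + e); lra.
have d'0 : 0 < d' by rewrite lt_min d0 divr_gt0.
have [|U [oU NU muU]] := lebesgue_regularity_outer mN _ d'0.
  by rewrite [X in (X < _)%E](_ : _ = 0%E).
have mU : measurable U by apply: open_measurable.
have muU' : (mu U < d'%:E)%E.
  have -> : U = N `|` (U `\` N) by rewrite setDUK.
  rewrite measureU //; last 2 first.
    by apply: measurableD.
    by rewrite setDE setICA setICr setI0.
  by rewrite [X in (X + _)%E](_ : _ = 0%E) ?add0e //; exact: muN0.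
(* Around a point of [U] the interval joins the cover. Any other point avoids the null set, so the
   derivative is at most [K] there, and the extra [e] absorbs the first-order error. *)
have : covered g U (K + e) a b.
  apply: (@real_induction _ _ a b) => //.
    exists 0%N, (fun=> 0), (fun=> 0); split => //; rewrite big_ord0 //.
    by rewrite !subrr mulr0 addr0.
  move=> s /andP[as_ sb]; have [/oU sU|sU] := pselect (U s).
    move: sU => /nbhs_ballP[r r0 Hr]; exists r => // t /andP[at_ tb].
    split => /andP[h1 h2]; apply: covered_add => // z /=;
      rewrite in_itv /= => /andP[z1 z2]; apply: Hr;
      rewrite -ball_normE /= ltr_norml; apply/andP; split; lra.
  have [|dg Dg] : a <= s <= b -> derivable g s 1 /\ 'D_1 g s <= K.
    by apply: contrapT => h; apply/sU/NU/subN.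
    by rewrite as_ sb.
  have [r r0 Hr] := derive_approx _ _ _ _ _ dg e0.
  exists r => // t /andP[at_ tb]; split => /andP[h1 h2].
    apply: covered_slope => //.
    have := Hr t; rewrite ltr_norml => /(_ ltac:(lra)).
    rewrite (_ : _ *: _ = (t - s) * 'D_1 g s) // ler_norml => /andP[+ _].
    rewrite ler0_norm ?subr_le0 //.
    have : 0 <= (K - 'D_1 g s) * (s - t) by rewrite mulr_ge0 ?subr_ge0.
    lra.
  apply: covered_slope => //.
  have := Hr t; rewrite ltr_norml => /(_ ltac:(lra)).
  rewrite (_ : _ *: _ = (t - s) * 'D_1 g s) // ler_norml => /andP[_].
  rewrite ger0_norm ?subr_ge0 //.
  have : 0 <= (K - 'D_1 g s) * (t - s) by rewrite mulr_ge0 ?subr_ge0.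
  lra.
move=> [n [l [r [H1 H2 H3 H4]]]].
have sd : \sum_(i < n) (r i - l i) < d'.
  rewrite -lte_fin; apply: (le_lt_trans H3); apply: le_lt_trans muU'.
  by apply: le_measure; rewrite ?inE //; apply: measurableI.
have vg : \sum_(i < n) `|g (r i) - g (l i)| < e.
  apply: (Hd n l r) => //; last by apply: (lt_le_trans sd); rewrite /d' ge_min lexx.
  by move=> i /H1[? ?]; split => //; apply: le_trans a0 _.
apply: (le_trans H4); rewrite lerD2l big_split /= -mulr_sumr.
suff : `|K + e| * (\sum_(i < n) (r i - l i)) <= e by lra.
apply: (@le_trans _ _ ((`|K + e| + 1) * d')).
  apply: ler_pM => //; last exact: ltW.
    by apply: sumr_ge0 => i _; have [_ []] := H1 i (ltn_ord i); lra.
  by rewrite lerDl.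
by rewrite mulrC -ler_pdivlMr // /d' ge_min lexx orbT.
Qed.

End absolute_continuity.

(** * Real inner products *)

Section inner_product.
Variables (R : realType) (H : normedModType R) (ip : H -> H -> R).
Hypothesis ipH : is_inner_product ip.

Lemma ipC u w : ip u w = ip w u. Proof. by case: ipH. Qed.

Lemma ipxx u : ip u u = `|u| ^+ 2. Proof. by case: ipH. Qed.

Lemma ipDl u w z : ip (u + w) z = ip u z + ip w z.
Proof. by have [_ + _] := ipH; move/(_ 1 u w z); rewrite scale1r mul1r. Qed.

Lemma ip0l z : ip 0 z = 0.
Proof.
by have := ipDl 0 0 z; rewrite addr0 -[LHS]addr0 => /addrI.
Qed.

Lemma ipZl a u z : ip (a *: u) z = a * ip u z.
Proof. by have [_ + _] := ipH; move/(_ a u 0 z); rewrite addr0 ip0l addr0. Qed.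

Lemma ipNl u z : ip (- u) z = - ip u z.
Proof. by rewrite -scaleN1r ipZl mulN1r. Qed.

Lemma ipDr u w z : ip z (u + w) = ip z u + ip z w.
Proof. by rewrite !(ipC z) ipDl. Qed.

Lemma ipZr a u z : ip z (a *: u) = a * ip z u.
Proof. by rewrite !(ipC z) ipZl. Qed.

Lemma ipNr u z : ip z (- u) = - ip z u.
Proof. by rewrite !(ipC z) ipNl. Qed.

Definition ipE := (ipDl, ipDr, ipZl, ipZr, ipNl, ipNr).

Lemma sqr_normD u w : `|u + w| ^+ 2 = `|u| ^+ 2 + 2 * ip u w + `|w| ^+ 2.
Proof. by rewrite -!ipxx !ipE (ipC w u); ring. Qed.

Lemma sqr_normB u w : `|u - w| ^+ 2 = `|u| ^+ 2 - 2 * ip u w + `|w| ^+ 2.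
Proof. by rewrite sqr_normD ipNr normrN; ring. Qed.

Lemma Cauchy_Schwarz u w : `|ip u w| <= `|u| * `|w|.
Proof.
have [->|w0] := eqVneq w 0; first by rewrite ipC ip0l !normr0 mulr0.
have W0 : 0 < `|w| ^+ 2 by rewrite exprn_gt0 ?normr_gt0.
rewrite -(@ler_pXn2r _ 2) ?nnegrE ?mulr_ge0 // exprMn real_normK ?num_real //.
(* The expansion equals [|w|^2 (|u|^2 |w|^2 - (ip u w)^2)]. *)
have := sqr_ge0 `|(`|w| ^+ 2) *: u - ip u w *: w|.
rewrite sqr_normB !ipE -!ipxx !ipE !ipxx => h.
rewrite -(ler_pM2l W0); lra.
Qed.

Lemma ip_cvgr {T : Type} (F : set_system T) {FF : Filter F} (f : T -> H) u l :
  f @ F --> l -> ip u (f t) @[t --> F] --> ip u l.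
Proof.
move=> fl; apply/cvgrPdist_lt => e e0.
have c0 : 0 < `|u| + 1 by rewrite ltr_wpDl.
move/cvgrPdist_lt : fl => /(_ (e / (`|u| + 1))); rewrite divr_gt0 // => /(_ isT).
apply: filterS => t; rewrite ltr_pdivlMr // => ft.
rewrite -ipNr -ipDr; apply: (le_lt_trans (Cauchy_Schwarz _ _)).
apply: le_lt_trans ft; rewrite mulrDr mulr1 mulrC lerDl //.
Qed.

Lemma is_derive_sqr_norm (f : R -> H) (t : R) (p : H) : derivable f t 1 ->
  is_derive t 1 (fun s => `|f s - p| ^+ 2) (2 * ip (f t - p) ('D_1 f t)).
Proof.
move=> df; pose q (h : R) := h^-1 *: ((f \o shift t) (h *: 1) - f t).
have qD : q @ 0^' --> 'D_1 f t by exact: df.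
suff lim : (fun h => h^-1 *: (((fun s => `|f s - p| ^+ 2) \o shift t) (h *: 1)
    - `|f t - p| ^+ 2)) @ 0^' --> 2 * ip (f t - p) ('D_1 f t).
  by apply: DeriveDef; [exact: cvgP lim | exact: cvg_lim lim].
(* For [h != 0] this is exactly the difference quotient of the squared norm, since
   [f (t + h) - p = (f t - p) + h q(h)]. *)
have lim : (fun h => 2 * ip (f t - p) (q h) + h * (`|q h| * `|q h|)) @ 0^' -->
    2 * ip (f t - p) ('D_1 f t) + 0 * (`|'D_1 f t| * `|'D_1 f t|).
  apply: cvgD; first by apply: cvgM; [exact: cvg_cst | exact: ip_cvgr].
  apply: cvgM; first exact: cvg_within.
  by apply: cvgM; exact: cvg_norm.
rewrite mul0r addr0 in lim; apply: cvg_trans lim; apply: near_eq_cvg.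
near=> h; have h0 : h != 0 by near: h; exact: nbhs_dnbhs_neq.
have -> : ((fun s => `|f s - p| ^+ 2) \o shift t) (h *: 1) =
    `|(f t - p) + h *: q h| ^+ 2.
  by rewrite /q /= scalerA mulfV // scale1r; congr (`|_| ^+ 2); rewrite [RHS]addrC addrA subrK.
rewrite sqr_normD (ipZr h (q h)) (normrZ h (q h)) exprMn real_normK ?num_real // -expr2.
have scE (u : R) : h^-1 *: u = h^-1 * u by [].
rewrite scE.
by field.
Unshelve. all: by end_near. Qed.

End inner_product.

(** * Minimal norm over small sublevel sets *)

Lemma convex_fun_mid (R : realType) (H : normedModType R) (Phi : H -> \bar R) (r : R) u w :
  convex_fun Phi -> (Phi u <= r%:E)%E -> (Phi w <= r%:E)%E ->
  (Phi (2^-1 *: (u + w)) <= r%:E)%E.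
Proof.
move=> cPhi ur wr; have := cPhi 2^-1 u w ltac:(lra).
rewrite (_ : 1 - 2^-1 = 2^-1 :> R); last by lra.
rewrite -scalerDr => /le_trans; apply.
apply: (@le_trans _ _ (2^-1%:E * r%:E + 2^-1%:E * r%:E)%E).
  by apply: leeD; apply: lee_wpmul2l; rewrite ?lee_fin ?invr_ge0.
by rewrite -!EFinM -EFinD lee_fin; lra.
Qed.

(* The infimum of the norm over [Phi <= r] increases to [`|p|] as [r] decreases
   to 0. Almost minimisers over small sublevel sets form a Cauchy filter by the
   parallelogram identity, and its limit lies in [C]. *)
Lemma min_norm_sublevel (R : realType) (H : completeNormedModType R)
  (ip : H -> H -> R) (Phi : H -> \bar R) (p : H) (eta : R) :
  is_inner_product ip -> (forall z, (0 <= Phi z)%E) ->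
  convex_fun Phi -> closed_fun Phi ->
  min_norm_elt [set z | Phi z = 0%E] p -> 0 < eta ->
  exists2 r : R, 0 < r &
    forall z, (Phi z <= r%:E)%E -> `|p| ^+ 2 - eta <= `|z| ^+ 2.
Proof.
move=> ipH Phi0 cPhi clPhi [/= Cp minp] eta0.
(* Lower bounds for the squared norm that hold on some sublevel set. Every sublevel set contains
   [p], so [T] is bounded above by [|p|^2]; the claim amounts to its supremum [M] reaching that
   value. *)
pose T := [set m : R | exists2 r : R, 0 < r &
  forall z, (Phi z <= r%:E)%E -> m <= `|z| ^+ 2].
have Tp m : T m -> m <= `|p| ^+ 2.
  by move=> [r r0]; apply; rewrite Cp lee_fin ltW.
have hT : has_sup T.
  by split; [exists 0, 1 => // z _; exact: sqr_ge0 | exists (`|p| ^+ 2)].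
pose M := sup T.
have low (d : R) : 0 < d -> exists2 r : R, 0 < r &
    forall z, (Phi z <= r%:E)%E -> M - d <= `|z| ^+ 2.
  move=> d0; have [m [r r0 Hr] mM] := sup_adherent d0 hT.
  by exists r => // z /Hr; apply: le_trans; exact: ltW.
have up (d r : R) : 0 < d -> 0 < r ->
    exists2 z, (Phi z <= r%:E)%E & `|z| ^+ 2 < M + d.
  move=> d0 r0; apply: contrapT => nz.
  have : T (M + d).
    exists r => // z zr; rewrite leNgt; apply/negP => zM; apply: nz; by exists z.
  by move=> /(sup_upper_bound hT); rewrite -/M; lra.
suff pM : `|p| ^+ 2 <= M.
  have [r r0 Hr] := low eta eta0; exists r => // z /Hr; lra.
pose D := [set rd : R * R | 0 < rd.1 /\ 0 < rd.2].
pose B (rd : R * R) := [set z : H | (Phi z <= rd.1%:E)%E /\ `|z| ^+ 2 < M + rd.2].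
have FF : Filter (filter_from D B).
  apply: filter_from_filter; first by exists (1, 1).
  move=> [r d] [r' d'] [/= r0 d0] [/= r'0 d'0].
  exists (Num.min r r', Num.min d d'); first by split; rewrite /= lt_min ?r0 ?d0.
  move=> z [/=]; rewrite EFin_min le_min => /andP[zr zr'].
  rewrite -ltrBlDl lt_min !ltrBlDl => /andP[zd zd'].
  by split.
have PF : ProperFilter (filter_from D B).
  apply: filter_from_proper => -[r d] [/= r0 d0].
  by have [z z1 z2] := up d r d0 r0; exists z.
have cF : cvg (filter_from D B).
  apply: cauchy_cvg; apply: cauchy_exP => e e0.
  (* With [d = e^2 / 16], the parallelogram identity gives [|z - w|^2 < 4 (M + d) - 4 (M - d) = e^2
     / 2], the midpoint being in the same sublevel set. *)
  have d0 : 0 < e ^+ 2 / 16 by rewrite divr_gt0 ?exprn_gt0.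
  have [r r0 Hr] := low _ d0; have [z zr zM] := up _ r d0 r0.
  exists z, (r, e ^+ 2 / 16) => // w [/= wr wM].
  rewrite -ball_normE /= -(@ltr_pXn2r _ 2) ?nnegrE ?(ltW e0) //.
  have := Hr _ (convex_fun_mid _ _ _ _ _ _ cPhi zr wr).
  rewrite normrZ exprMn real_normK ?num_real // (sqr_normB _ _ _ ipH) (sqr_normD _ _ _ ipH).
  lra.
set l := lim (filter_from D B) in cF.
have closed_lim (A : set H) r d : 0 < r -> 0 < d -> closed A -> B (r, d) `<=` A -> A l.
  move=> r0 d0 clA BA; apply: (@closed_cvg _ _ (filter_from D B) PF id A) => //.
  by exists (r, d).
(* Each closed sublevel set of positive level belongs to the filter, hence contains the limit. *)
have Cl : Phi l = 0%E.
  apply/eqP; rewrite eq_le Phi0 andbT; apply/lee_addgt0Pr => r r0; rewrite add0e.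
  apply: (closed_lim [set z | (Phi z <= r%:E)%E] r 1) => //.
  by move=> z [].
apply: (@le_trans _ _ (`|l| ^+ 2)).
  by rewrite ler_pXn2r ?nnegrE //; exact: minp.
apply/ler_addgt0Pr => d d0.
apply: (closed_lim [set z : H | `|z| ^+ 2 <= M + d] 1 d) => //.
- apply: (@closed_comp _ _ (fun z : H => `|z| ^+ 2) [set s | s <= M + d]).
    move=> z _; apply: (@continuous_comp _ _ _ (@Num.norm _ H) (fun s : R => s ^+ 2)).
      exact: norm_continuous.
    exact: exprn_continuous.
  exact: closed_le.
- by move=> z [_ /ltW].
Qed.

(** * A Gronwall argument with a non-integrable rate *)

(** On each unit interval [f] is at most its value at the left endpoint. In contrapositive form, an
    infinite integral forces unbounded partial sums. *)
Lemma integral_nonincreasing_le (R : realType) (f : R -> R) (B : R) :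
  (forall t : R, 0 <= t -> 0 <= f t) ->
  (forall s t : R, 0 <= s -> s <= t -> f t <= f s) ->
  (forall n, \sum_(i < n) f i%:R <= B) ->
  (\int[lebesgue_measure]_(t in `[0%R, +oo[) (f t)%:E <= B%:E)%E.
Proof.
move=> f0 fni fB.
pose F (i : nat) : set R := `[i%:R, i.+1%:R[%classic.
have FP i t : F i t = (i%:R <= t < i.+1%:R) :> Prop by rewrite /F /= in_itv.
have mF i : measurable (F i) by exact: measurable_itv.
have FE : `[0%R, +oo[%classic = \bigcup_i F i.
  apply/seteqP; split => [t|t [i _]]; rewrite ?FP /= in_itv /= andbT => h.
    by exists (Num.truncn t) => //; rewrite FP truncn_itv.
  by move/andP: h => [h _]; apply: (le_trans _ h).
(* Monotonicity is known on the half-line only; freezing [f] at [f 0] on the negatives gives a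
   globally monotone, hence measurable, function. *)
have f'ni : nonincreasing_fun (fun t => f (Num.max 0 t)).
  by move=> s t st; apply: fni; [rewrite le_max lexx | rewrite ge_max !le_max lexx st orbT].
have mf : measurable_fun (`[0%R, +oo[%classic : set (measurableTypeR R)) (fun t : R => (f t)%:E).
  apply: (eq_measurable_fun (fun t : R => (f (Num.max 0 t))%:E)).
    by move=> t; rewrite inE /= in_itv /= andbT => t0; rewrite max_r.
  apply/measurable_EFinP.
  exact: nonincreasing_measurable.
rewrite FE ge0_integral_bigcup.
- apply: lime_le.
    by apply: is_cvg_nneseries => n _ _; apply: integral_ge0 => t; rewrite FP
      => /andP[h _]; rewrite lee_fin f0 // (le_trans _ h).
  apply: nearW => n; apply: (@le_trans _ _ (\sum_(0 <= i < n) (f i%:R)%:E)%E).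
    apply: lee_sum => i _.
    apply: (@le_trans _ _ (\int[lebesgue_measure]_(t in F i) (cst (f i%:R)%:E t))%E).
      apply: ge0_le_integral.
      + exact: mF.
      + by move=> t; rewrite FP => /andP[h _]; rewrite lee_fin f0 // (le_trans _ h).
      + apply: measurable_funS mf => //.
        by rewrite FE; exact: bigcup_sup.
      + exact: measurable_cst.
      + by move=> t; rewrite FP => /andP[h _]; rewrite lee_fin fni.
    rewrite integral_cst; last exact: mF.
    rewrite [X in (_ * X)%E](_ : _ = 1%E) ?mule1 //.
    transitivity (lebesgue_measure (F i)) => //.
    by rewrite lebesgue_measure_itv /= lte_fin ltr_nat ltnSn -EFinB -natrB // subSnn.
  by rewrite sumEFin lee_fin big_mkord.
- exact: mF.
- by rewrite -FE.
- by move=> t; rewrite -FE /= in_itv /= andbT => t0; rewrite lee_fin f0.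
- apply/trivIsetP => i j _ _ ij; apply/seteqP; split => // t [].
  rewrite !FP => /andP[it ti] /andP[jt tj].
  have := le_lt_trans it tj; have := le_lt_trans jt ti; rewrite !ltr_nat !ltnS => ji ij'.
  by move: ij; rewrite eqn_leq ij' ji.
Qed.

(** * Boundedness and stability properties of absolutely continuous functions *)

Section absolute_continuity_closure.
Variables (R : realType) (H : normedModType R).
Implicit Types (f g : R -> H) (b : R).

Lemma abs_cont_unif f b : abs_cont_on_0b f b -> forall e : R, 0 < e ->
  exists2 d : R, 0 < d & forall s t, 0 <= s -> s <= t -> t <= b -> t < s + d ->
    `|f t - f s| < e.
Proof.
move=> acf e /acf[d d0 Hd]; exists d => // s t s0 st tb tsd.
have := Hd 1%N (fun=> s) (fun=> t); rewrite !big_ord_recl !big_ord0 !addr0; apply => //.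
by lra.
Qed.

(** Uniform continuity with tolerance 1 lets a bound grow by at most 1 over any step shorter than
    [d]; real induction reaches [b]. *)
Lemma abs_cont_bounded f b : 0 <= b -> abs_cont_on_0b f b ->
  exists M : R, forall t, 0 <= t <= b -> `|f t| <= M.
Proof.
move=> b0 acf; have [d d0 Hd] := abs_cont_unif f b acf 1 ltr01.
pose P t := exists M : R, forall s, 0 <= s <= t -> `|f s| <= M.
have step s t : 0 <= s -> s <= t -> t <= b -> t < s + d -> P s -> P t.
  move=> s0 st tb tsd [M HM]; exists (M + 1) => r /andP[r0 rt].
  have [rs|sr] := leP r s; first by have := HM r; rewrite r0 rs => /(_ isT); lra.
  have := Hd s r s0 (ltW sr) ltac:(lra) ltac:(lra).
  have := HM s; rewrite s0 lexx => /(_ isT).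
  have := ler_normD (f r - f s) (f s); rewrite subrK; lra.
apply: (@real_induction R P 0 b) => //.
  exists `|f 0| => s; rewrite andbC => s0.
  by have -> : s = 0 by apply/eqP; rewrite eq_le.
move=> s /andP[s0 sb]; exists d => // t /andP[t0 tb].
by split=> /andP[h1 h2]; apply: step => //; lra.
Qed.

Lemma abs_contDZ f g (c b : R) : abs_cont_on_0b f b -> abs_cont_on_0b g b ->
  abs_cont_on_0b (fun t => f t + c *: g t) b.
Proof.
move=> acf acg e e0.
have c0 : 0 < `|c| + 1 by rewrite ltr_wpDl.
have e'0 : 0 < e / 2 / (`|c| + 1) by rewrite !divr_gt0.
have [d1 d10 H1] := acf (e / 2) ltac:(lra).
have [d2 d20 H2] := acg _ e'0.
exists (Num.min d1 d2) => [|n l r h1 h2]; first by rewrite lt_min d10.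
rewrite lt_min => /andP[/(H1 _ _ _ h1 h2) F /(H2 _ _ _ h1 h2) G].
apply: (@le_lt_trans _ _ (\sum_(i < n) (`|f (r i) - f (l i)| +
    `|c| * `|g (r i) - g (l i)|))).
  apply: ler_sum => i _; rewrite opprD addrACA -scalerBr -normrZ.
  exact: ler_normD.
rewrite big_split /= -mulr_sumr.
move: G; rewrite ltr_pdivlMr //.
have : 0 <= \sum_(i < n) `|g (r i) - g (l i)| by apply: sumr_ge0.
lra.
Qed.

(** A difference of squares factors, and boundedness of [f] on [[0, b]] controls the sum of the two
    norms by [2 (M + |p|)]. *)
Lemma abs_cont_sqr_norm f p b : 0 <= b -> abs_cont_on_0b f b ->
  abs_cont_on_0b (fun t => `|f t - p| ^+ 2 : R) b.
Proof.
move=> b0 acf; have [M HM] := abs_cont_bounded f b b0 acf.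
have HM' t : 0 <= t <= b -> `|f t - p| <= M + `|p|.
  by move=> /HM fM; apply: (le_trans (ler_normB _ _)); rewrite lerD2r.
have M0 : 0 <= M by apply: le_trans (HM 0 _); rewrite ?lexx.
have c0 : 0 < 2 * (M + `|p|) + 1 by have := normr_ge0 p; lra.
move=> e e0; have [d d0 Hd] := acf (e / (2 * (M + `|p|) + 1)) ltac:(by rewrite divr_gt0).
exists d => // n l r h1 h2 h3; have := Hd n l r h1 h2 h3.
rewrite ltr_pdivlMr // mulrC; apply: le_lt_trans; rewrite mulr_sumr.
apply: ler_sum => i _; have [l0 [lr rb]] := h1 i (ltn_ord i).
rewrite subr_sqr normrM mulrC; apply: ler_pM => //.
  apply: (le_trans (ler_dist_dist _ _)).
  by rewrite opprB addrA subrK.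
apply: (le_trans (ler_normD _ _)); rewrite !normr_id.
have := HM' (l i); rewrite l0 (le_trans lr rb) => /(_ isT).
have := HM' (r i); rewrite rb (le_trans l0 lr) => /(_ isT); lra.
Qed.

End absolute_continuity_closure.

(** A barrier argument instead of an exponential weight. While [N >= e], the slope is at most
    [- eta * eps]; the infinite integral forces [N] down to level [e] at some time, and the sign of
    the slope prevents it from rising above [e] later. *)
Lemma abs_cont_gronwall_cvg0 (R : realType) (N eps : R -> R) (kappa : R) :
  0 < kappa ->
  (forall t : R, 0 <= N t) -> (forall b : R, 0 <= b -> abs_cont_on_0b N b) ->
  (forall t : R, 0 <= t -> 0 <= eps t) ->
  (forall s t : R, 0 <= s -> s <= t -> eps t <= eps s) ->
  (\int[lebesgue_measure]_(t in `[0%R, +oo[) (eps t)%:E = +oo)%E ->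
  (forall eta : R, 0 < eta -> exists2 T : R, 0 <= T &
     {ae lebesgue_measure, forall t : R, T <= t -> derivable N t 1 /\
        'D_1 N t <= - (eps t * (kappa * N t - eta))}) ->
  N t @[t --> +oo] --> 0.
Proof.
move=> kappa0 N0 acN eps0 epsni epsoo HN.
apply/cvgrPdist_le => /= e e0.
(* Chosen so that [N t >= e] implies [kappa * N t - eta >= eta]. *)
pose eta := kappa * e / 2.
have eta0 : 0 < eta by rewrite !mulr_gt0.
have [T T0 HT] := HN eta eta0.
have step a b : T <= a -> a <= b -> (forall t, a <= t <= b -> e <= N t) ->
    N b - N a <= - (eta * eps b) * (b - a).
  move=> Ta ab Ne; apply: abs_cont_slope_le => //; first exact: le_trans Ta.
    by apply: acN; apply: le_trans ab; apply: le_trans Ta.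
  have [A [mA A0 sA]] := HT; exists A; split => // t nt; apply: sA => Ht; apply: nt.
  move=> /andP[at_ tb]; have [dN DN] := Ht (le_trans Ta at_).
  split=> //; apply: (le_trans DN); rewrite lerN2 mulrC.
  have t0 : 0 <= t by lra.
  have et : eta <= kappa * N t - eta.
    have := Ne t; rewrite at_ tb => /(_ isT); rewrite -(ler_pM2l kappa0) /eta; lra.
  by apply: ler_pM => //; [exact/eps0/(le_trans t0)|exact: ltW|exact: epsni].
have [t0 Tt0 Nt0] : exists2 t0, T <= t0 & N t0 <= e.
  apply: contrapT => nN.
  have Ne t : T <= t -> e <= N t.
    by move=> Tt; rewrite leNgt; apply/negP => Nt; apply: nN; exists t; rewrite // ltW.
  pose n0 := (Num.truncn T).+1.
  have Tn0 : T <= n0%:R by rewrite ltW // truncnS_gt.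
  (* Telescoping over unit intervals from [n0]. Each contributes [eps] at its right endpoint, its
     least value there, so the sum starts at [n0.+1]; the earlier terms are added back as a
     constant. *)
  have bound n : eta * \sum_(i < n) eps (n0.+1 + i)%:R <= N n0%:R - N (n0 + n)%:R.
    elim: n => [|n IH]; first by rewrite big_ord0 mulr0 addn0 subrr.
    rewrite big_ord_recr /= mulrDr.
    have := step (n0 + n)%:R (n0 + n.+1)%:R.
    rewrite addnS (le_trans Tn0) ?ler_nat ?leq_addr // => /(_ isT).
    have Ne' t : (n0 + n)%:R <= t <= (n0 + n).+1%:R -> e <= N t.
      move=> /andP[ht _]; apply: Ne; apply: le_trans ht.
      by rewrite (le_trans Tn0) // ler_nat leq_addr.
    rewrite leqnSn => /(_ isT Ne').
    by rewrite addSn -natrB // subSnn mulr1; lra.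
  suff : (+oo <= (\sum_(i < n0.+1) eps i%:R + N n0%:R / eta)%:E)%E by [].
  rewrite -epsoo; apply: integral_nonincreasing_le => // n.
  apply: (@le_trans _ _ (\sum_(i < n0.+1 + n) eps i%:R)).
    rewrite addnC big_split_ord /= lerDl sumr_ge0 // => i _; exact: eps0.
  rewrite big_split_ord /= lerD2l ler_pdivlMr // mulrC.
  by apply: (le_trans (bound n)); rewrite gerBl.
near=> t1; rewrite sub0r normrN ger0_norm // leNgt; apply/negP => Nt1.
have t01 : t0 <= t1 by near: t1; apply: nbhs_pinfty_ge; rewrite num_real.
have t00 : 0 <= t0 by exact: le_trans Tt0.
(* Its supremum is the last time up to [t1] at which [N] is at most [e], by continuity. *)
pose S := [set t : R | t0 <= t <= t1 /\ N t <= e].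
have St0 : S t0 by rewrite /S /= lexx.
have hS : has_sup S by split; [exists t0 | exists t1 => t [/andP[_ ?] _]].
have t0s : t0 <= sup S by apply: sup_upper_bound.
have st1 : sup S <= t1 by apply: ge_sup => [|t [/andP[_ ?] _] //]; exists t0.
have uc := abs_cont_unif R _ N t1 (acN _ (le_trans t00 t01)).
have Ns : N (sup S) <= e.
  apply/ler_addgt0Pr => r /uc[d d0 Hd].
  have [t [/andP[t0t tt1] Nt] st] := sup_adherent d0 hS.
  have ts : t <= sup S by apply: sup_upper_bound => //; split; rewrite ?t0t.
  have := Hd t (sup S) (le_trans t00 t0t) ts st1 ltac:(lra).
  by rewrite ltr_norml => /andP[_]; lra.
suff : N t1 <= e by rewrite leNgt Nt1.
apply/ler_addgt0Pr => r /uc[d d0 Hd].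
have st1' : sup S < t1.
  by rewrite lt_neqAle st1 andbT; apply/eqP => st; move: Ns; rewrite st leNgt Nt1.
(* Starting just after [sup S] guarantees [N >= e] on all of [[t, t1]], so that [step] applies; the
   shift costs less than [r]. *)
pose t := Num.min t1 (sup S + d / 2).
have st : sup S < t by rewrite /t lt_min st1' ltrDl divr_gt0.
have tt1 : t <= t1 by rewrite /t ge_min lexx.
have td : t < sup S + d by rewrite /t gt_min; apply/orP; right; lra.
have := Hd (sup S) t (le_trans t00 t0s) (ltW st) tt1 td.
rewrite ltr_norml => /andP[_ Nts].
have Ne u : t <= u <= t1 -> e <= N u.
  move=> /andP[tu ut1]; rewrite leNgt; apply/negP => Nu.
  have : u <= sup S by apply: sup_upper_bound => //; split; [apply/andP; split|]; lra.
  by lra.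
have := step t t1 ltac:(lra) tt1 Ne.
have : 0 <= eta * eps t1 * (t1 - t).
  apply: mulr_ge0; last by rewrite subr_ge0.
  by apply: mulr_ge0; [exact: ltW | apply: eps0; exact: le_trans t01].
by lra.
Unshelve. all: by end_near. Qed.

(** * Energy estimate and convergence *)

Section energy.
Variables (R : realType) (H : normedModType R) (ip : H -> H -> R).
Hypothesis ipH : is_inner_product ip.

(** Moving everything to one side and dividing by [mu] leaves the sum of [2 (ip v (x - p) - f)],
    half of [n1], [mu] times [n2], [mu] times [n3], and [n4], where each name stands for its
    nonnegative quantity. *)
Lemma energy_decay (x v p : H) (mu ep f eta r : R) :
  0 < mu -> 0 <= ep -> mu * ep <= 1 -> mu * (ep * `|p| ^+ 2) <= eta ->
  ep * `|p| ^+ 2 <= 2 * r -> 0 <= eta -> 0 <= f -> f <= ip v (x - p) ->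
  (f <= r -> `|p| ^+ 2 - eta <= `|x| ^+ 2) ->
  2 * ip (x + mu *: v - p) (- (mu *: (v + ep *: x))) <=
  - (ep * (mu / 2 * `|x + mu *: v - p| ^+ 2 - mu * 2 * eta)).
Proof.
move=> mu0 ep0 me mp pr eta0 f0 fv fx.
have n1 := mulr_ge0 ep0 (sqr_ge0 `|x - p - mu *: v|).
have n2 := sqr_ge0 `|v + ep *: x|.
have n3 : 0 <= (1 - mu * ep) * `|v| ^+ 2 by rewrite mulr_ge0 ?sqr_ge0 ?subr_ge0.
(* If [f <= r], the lower bound on [|x|^2] applies and [mu * ep * |p|^2 <= eta] absorbs the
   second-order loss. Otherwise [2 * f > 2 * r] already dominates [ep * |p|^2]. *)
have n4 : 0 <= 2 * f + ep * (1 - mu * ep) * `|x| ^+ 2 - ep * `|p| ^+ 2 + 2 * ep * eta.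
  have [fr|rf] := leP f r.
    have : 0 <= (ep * (1 - mu * ep)) * (`|x| ^+ 2 - (`|p| ^+ 2 - eta)).
      by rewrite !mulr_ge0 ?subr_ge0 ?fx.
    have : 0 <= ep * (eta - mu * (ep * `|p| ^+ 2)) by rewrite mulr_ge0 ?subr_ge0.
    have : 0 <= mu * ep ^+ 2 * eta by rewrite !mulr_ge0 ?sqr_ge0 // ltW.
    lra.
  have : 0 <= ep * (1 - mu * ep) * `|x| ^+ 2.
    by rewrite !mulr_ge0 ?subr_ge0 ?sqr_ge0.
  have : 0 <= 2 * ep * eta by rewrite !mulr_ge0.
  lra.
move: n1 n2 n3 n4 fv.
rewrite -!(ipxx _ _ _ ipH) !(ipE _ _ _ ipH).
rewrite !(ipC _ _ _ ipH v x) !(ipC _ _ _ ipH p x) !(ipC _ _ _ ipH p v).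
set X := ip x x; set V := ip v v; set A := ip p p.
set a := ip x v; set b := ip x p; set c := ip v p.
move=> n1 n2 n3 n4 fv.
have : 0 <= mu * (2 * (a - c + mu * V + ep * (X + mu * a - b))
   - ep * ((X + mu ^+ 2 * V + A + 2 * mu * a - 2 * b - 2 * mu * c) / 2) + 2 * ep * eta).
  have := ler_wpM2l (ltW mu0) n2.
  rewrite mulr0 => n2'; apply: mulr_ge0; first exact: ltW.
  have n3' := ler_wpM2l (ltW mu0) n3.
  lra.
lra.
Qed.

(** The subgradient inequality tested at a zero of [Phi], transferred to real numbers since [Phi x]
    is finite. *)
Lemma subdiff_ge0 (Phi : H -> \bar R) (x v p : H) :
  (forall z, (0 <= Phi z)%E) -> Phi p = 0%E -> subdiff ip Phi x v ->
  exists f : R, [/\ Phi x = f%:E, 0 <= f & f <= ip v (x - p)].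
Proof.
move=> Phi0 Phip [xoo /(_ p)]; rewrite Phip; move: xoo (Phi0 x).
case: (Phi x) => [f|//|//] _; rewrite lee_fin => f0.
rewrite -EFinD lee_fin -opprB (ipNr _ _ _ ipH) => fv.
by exists f; split => //; lra.
Qed.

(** The cross term of the expanded square is nonnegative. Convergence of [x + mu v] to [p] thus
    passes to both [x] and [v]. *)
Lemma sqr_dist_resolvent (x v p : H) (mu : R) : 0 <= mu -> 0 <= ip v (x - p) ->
  `|x - p| ^+ 2 + mu ^+ 2 * `|v| ^+ 2 <= `|x + mu *: v - p| ^+ 2.
Proof.
move=> mu0 vx; rewrite addrAC (sqr_normD _ _ _ ipH (x - p)) (ipZr _ _ _ ipH) (ipC _ _ _ ipH).
rewrite normrZ exprMn real_normK ?num_real // lerD2r lerDl.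
by rewrite !mulr_ge0.
Qed.

End energy.

Lemma cvg0_sqr_norm_le (R : realType) (H : normedModType R) (T : Type)
  (F : set_system T) (g : T -> H) (N : T -> R) (C : R) : Filter F -> 0 < C ->
  N t @[t --> F] --> 0 -> (\forall t \near F, `|g t| ^+ 2 <= C * N t) ->
  g t @[t --> F] --> (0 : H).
Proof.
move=> FF C0 /cvgrPdist_lt N0 gN; apply/cvgrPdist_lt => e e0.
have := N0 (e ^+ 2 / C); rewrite divr_gt0 ?exprn_gt0 // => /(_ isT).
apply: filterS2 gN => t gt; rewrite !sub0r !normrN ltr_pdivlMr // => Nt.
rewrite -(@ltr_pXn2r _ 2) ?nnegrE ?(ltW e0) //; apply: (le_lt_trans gt).
by apply: le_lt_trans Nt; rewrite mulrC ler_wpM2r ?ler_norm // ltW.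
Qed.

Theorem theorem3p2 (R : realType) (H : completeNormedModType R)
  (ip : H -> H -> R) (lam : R) (Phi : H -> \bar R) (eps : R -> R)
  (deps : R -> R) (k : R) (x v : R -> H) :
  is_inner_product ip ->
  0 < lam ->
  (forall z, (0 <= Phi z)%E) ->
  convex_fun Phi -> closed_fun Phi ->
  (exists z, Phi z = 0%E) ->
  (* (H1) *)
  (forall p, range_normal_cone ip [set z | Phi z = 0%E] p ->
     (\int[lebesgue_measure]_(t in `[0%R, +oo[)
        (lam^-1%:E * fenchel ip Phi (lam *: (eps t *: p))
         - support_fun ip [set z | Phi z = 0%E] (eps t *: p)
         + (2^-1 * `|eps t *: p| ^+ 2)%:E) < +oo)%E) ->
  (* (H2) *)
  (forall t : R, 0 <= t -> 0 <= eps t) ->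
  (forall s t : R, 0 <= s -> s <= t -> eps t <= eps s) ->
  (forall t : R, 0 < t -> is_derive t 1 eps (deps t)) ->
  {within `[0, +oo[, continuous deps} ->
  (exists L : R, forall s t : R, 0 <= s -> 0 <= t ->
      `|eps s - eps t| <= L * `|s - t|) ->
  eps t @[t --> +oo] --> 0 ->
  (\int[lebesgue_measure]_(t in `[0%R, +oo[) (eps t)%:E = +oo)%E ->
  0 <= k ->
  (forall t : R, 0 <= t -> - k * eps t ^+ 2 <= deps t) ->
  (* strong global solution *)
  (forall b, 0 <= b -> abs_cont_on_0b x b /\ abs_cont_on_0b v b) ->
  (forall t : R, 0 <= t -> subdiff ip Phi (x t) (v t)) ->
  {ae lebesgue_measure, forall t : R, 0 <= t ->
     [/\ derivable x t 1, derivable v t 1 &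
         lam *: 'D_1 x t + 'D_1 v t + v t + eps t *: x t = 0]} ->
  let y := fun t => x t + lam^-1 *: v t in
  forall p, min_norm_elt [set z | Phi z = 0%E] p ->
  weak_cvg_oo ip y p /\
  ((Phi 0%R < +oo)%E ->
     [/\ weak_cvg_oo ip x p, weak_cvg_oo ip y p,
         v t @[t --> +oo] --> (0 : H)
       & x t - y t @[t --> +oo] --> (0 : H)]).
Proof.
move=> ipH lam0 Phi0 cPhi clPhi _ _ eps0 epsni _ _ _ epscvg epsoo _ _ ac sd ode y p minp.
have mu0 : 0 < lam^-1 by rewrite invr_gt0.
pose N t := `|y t - p| ^+ 2.
have Phip : Phi p = 0%E by case: minp.
have small (c d : R) : 0 <= c -> 0 < d -> \forall t \near +oo, c * eps t <= d.
  move=> c0 d0; have c10 : 0 < c + 1 by lra.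
  move/cvgrPdist_le : epscvg => /(_ (d / (c + 1))); rewrite divr_gt0 // => /(_ isT).
  apply: filterS => t; rewrite sub0r normrN ler_pdivlMr // => et.
  have := ler_wpM2l c0 (ler_norm (eps t)).
  by have := normr_ge0 (eps t); lra.
have N_cvg : N t @[t --> +oo] --> 0.
  apply: (@abs_cont_gronwall_cvg0 _ N eps (lam^-1 / 2)) => //.
  - by rewrite divr_gt0.
  - by move=> t; exact: sqr_ge0.
  - move=> b b0; have [acx acv] := ac b b0.
    by apply: abs_cont_sqr_norm => //; exact: abs_contDZ.
  (* Rescaled to match the error term [mu * 2 * eta'] of [energy_decay]. *)
  move=> eta eta0; pose eta' := eta / (lam^-1 * 2).
  have eta'0 : 0 < eta' by rewrite !(divr_gt0, mulr_gt0).
  have [r r0 Hr] := min_norm_sublevel _ _ _ _ _ _ ipH Phi0 cPhi clPhi minp eta'0.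
  have [M [_ HM]] : \forall t \near +oo, [/\ lam^-1 * eps t <= 1,
      lam^-1 * `|p| ^+ 2 * eps t <= eta' & `|p| ^+ 2 * eps t <= 2 * r].
    near=> t; split; near: t; apply: small; rewrite ?mulr_ge0 ?sqr_ge0 ?(ltW mu0) //.
    by rewrite mulr_gt0.
  (* Eventual properties hold for [t > M] strictly, whereas the threshold is non-strict; hence
     [M + 1]. *)
  exists (Num.max 0 (M + 1)); first by rewrite le_max lexx.
  have [A [mA A0 sA]] := ode; exists A; split => // t nt; apply: sA => Ht; apply: nt.
  move=> /=; rewrite ge_max => /andP[t0 Mt].
  have [dx dv E] := Ht t0.
  have [f [Phif f0 fv]] := subdiff_ge0 _ _ _ ipH _ _ _ _ Phi0 Phip (sd t t0).
  have [h1 h2 h3] := HM t ltac:(lra).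
  have dmv : derivable (lam^-1 \*: v) t 1 by exact: derivableZ.
  have dy : derivable y t 1 by exact: (derivableD dx dmv).
  (* The differential equation divided by [lam]. *)
  have Dy : 'D_1 y t = - (lam^-1 *: (v t + eps t *: x t)).
    have -> : 'D_1 y t = 'D_1 x t + lam^-1 *: 'D_1 v t.
      by rewrite -deriveZ // -deriveD.
    apply/eqP; rewrite -addr_eq0 -(scalerK (lt0r_neq0 lam0) ('D_1 x t)) -!scalerDr.
    by rewrite addrA E scaler0.
  have DN := is_derive_sqr_norm _ _ _ ipH y t p dy.
  split; first exact: (@ex_derive _ _ _ _ _ _ _ DN).
  rewrite (@derive_val _ _ _ _ _ _ _ DN) Dy.
  rewrite (_ : eta = lam^-1 * 2 * eta'); last first.
    by rewrite mulrC divfK // mulf_neq0 // gt_eqF.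
  apply: (@energy_decay _ _ _ ipH _ _ _ _ _ f _ r) => //.
  - exact: eps0.
  - by rewrite (mulrC (eps t)) mulrA.
  - by rewrite mulrC.
  - exact: ltW.
  - by move=> fr; apply: Hr; rewrite Phif lee_fin.
have bound : \forall t \near +oo,
    `|x t - p| ^+ 2 + lam^-1 ^+ 2 * `|v t| ^+ 2 <= N t.
  near=> t; have t0 : 0 <= t by near: t; apply: nbhs_pinfty_ge; rewrite num_real.
  have [f [_ f0 fv]] := subdiff_ge0 _ _ _ ipH _ _ _ _ Phi0 Phip (sd t t0).
  apply: (sqr_dist_resolvent _ _ _ ipH); first exact: ltW.
  exact: le_trans fv.
have yp : y t - p @[t --> +oo] --> (0 : H).
  apply: (cvg0_sqr_norm_le _ _ _ _ _ N 1) => //.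
  by apply: nearW => t; rewrite mul1r.
have xp : x t - p @[t --> +oo] --> (0 : H).
  apply: (cvg0_sqr_norm_le _ _ _ _ _ N 1) => //.
  apply: filterS bound => t; rewrite mul1r; apply: le_trans.
  by rewrite lerDl mulr_ge0 ?sqr_ge0.
have v0 : v t @[t --> +oo] --> (0 : H).
  apply: (cvg0_sqr_norm_le _ _ _ _ _ N (lam ^+ 2)) => //; first exact: exprn_gt0.
  apply: filterS bound => t bt; have l20 : 0 < lam ^+ 2 by exact: exprn_gt0.
  rewrite -(ler_pdivrMl _ _ l20) -exprVn.
  by apply: le_trans bt; rewrite lerDr sqr_ge0.
(* Norm convergence implies weak convergence, by continuity of [ip z]. *)
have weak (g : R -> H) : g t - p @[t --> +oo] --> (0 : H) -> weak_cvg_oo ip g p.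
  move=> gp z; have zg : ip z (g t - p) @[t --> +oo] --> 0.
    by rewrite -(ip0l _ _ _ ipH z) (ipC _ _ _ ipH 0); exact: (ip_cvgr _ _ _ ipH).
  rewrite -[X in _ --> X]add0r.
  rewrite (_ : (fun t => ip (g t) z) = (fun t => ip z (g t - p) + ip p z)).
    by apply: (cvgD zg); exact: cvg_cst.
  by apply/funext => t; rewrite (ipC _ _ _ ipH z) -(ipDl _ _ _ ipH) subrK.
split; first exact: weak.
move=> _; split => //; try exact: weak.
rewrite (_ : (fun t => x t - y t) = (fun t => (- lam^-1) *: v t)).
  by rewrite -[X in _ --> X](scaler0 _ (- lam^-1)); apply: cvgZ => //; exact: cvg_cst.
by apply/funext => t; rewrite /y opprD addrA subrr add0r scaleNr.
Unshelve. all: by end_near. Qed.
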